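(* Let $(X,\mu)$ be a measure space, $0<q\leq\infty$, and $J\subseteq(0,\infty)$ such that $m_J>0$ and $M_J<\infty$, where $m_J=\inf\{p: p\in J\}$ and $M_J=\sup\{p: p\in J\}$. Then $$IL_{J,q}(X,\mu)=IL_{(m_J,M_J),q}(X,\mu)=IL_{[m_J,M_J),q}(X,\mu)=IL_{(m_J,M_J],q}(X,\mu)=IL_{[m_J,M_J],q}(X,\mu)=L_{m_J,q}(X,\mu)\cap L_{M_J,q}(X,\mu).$$ Furthermore, for each $f\in IL_{J,q}(X,\mu)$ and $p\in J$, $$\|f\|_{L_{p,q}}\leq 2^{1/q}\max\{\|f\|_{L_{m_J,q}},\|f\|_{L_{M_J,q}}\}.$$
   Context: For a complex-valued measurable function $f$ on a measure space $(X,\mu)$, let $d_f(\alpha)=\mu(\{x\in X:|f(x)|>\alpha\})$ for $\alpha>0$, and let $f^*:[0,\infty)\to[0,\infty]$, $f^*(t)=\inf\{s>0:d_f(s)\leq t\}$ (with $\inf\emptyset=\infty$), be the decreasing rearrangement of $f$. For $0<p\leq\infty$ and $0<q<\infty$ put $\|f\|_{L_{p,q}}=\left(\int_0^\infty (t^{1/p}f^*(t))^q\frac{dt}{t}\right)^{1/q}$, and for $q=\infty$ put $\|f\|_{L_{p,\infty}}=\sup_{t>0}t^{1/p}f^*(t)$. The Lorentz space $L_{p,q}(X,\mu)$ is the set of all $f$ with $\|f\|_{L_{p,q}}<\infty$, functions equal $\mu$-almost everywhere being identified. For $J\subseteq(0,\infty)$ and $0<q\leq\infty$, $$IL_{J,q}(X,\mu)=\Big\{f\in\bigcap_{p\in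 J}L_{p,q}(X,\mu):\ \|f\|_{L_{J,q}}=\sup_{p\in J}\|f\|_{L_{p,q}}<\infty\Big\},$$ and the spaces indexed by intervals with endpoints $m_J$ and $M_J$ are obtained by taking that interval in place of $J$. For $q=\infty$, $2^{1/q}$ is read as $1$.
   Formalization: J is assumed nonempty, and the equalities with the intervals (m_J,M_J), [m_J,M_J), (m_J,M_J] are stated only when m_J < M_J, since for a one-point J these intervals are empty and the equalities fail. *)

(* Defs.v *)
From HB Require Import structures.
From mathcomp Require Import all_boot all_order all_algebra.
From mathcomp Require Import all_classical all_reals all_analysis.
From mathcomp Require Import complex.

Set Implicit Arguments.
Unset Strict Implicit.
Unset Printing Implicit Defensive.

Import Order.TTheory GRing.Theory Num.Theory.
Import numFieldNormedType.Exports.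

Local Open Scope classical_set_scope.
Local Open Scope ring_scope.
Local Open Scope ereal_scope.

Definition borelC (R : realType) :=
  g_sigma_algebraType (@open (R[i] : numFieldType)).

Section lorentz_functions.
Context (R : realType) (d : measure_display) (X : measurableType d).
Variable mu : {measure set X -> \bar R}.
Implicit Types (f g : X -> borelC R) (p q : \bar R).

(* The norm of R[i] takes its values in R[i]; Normc.normc is the same modulus
   with values in R. *)
Definition distribution f (a : R) : \bar R :=
  mu [set x | (a < Normc.normc (f x))%R].

Definition rearrangement f (t : R) : \bar R :=
  ereal_inf [set s%:E | s in [set s : R |
    (0 < s)%R /\ distribution f s <= t%:E]].

(* (+oo)^-1 = 0 in \bar R, so that t `^ fine p^-1 is 1 for p = +oo.
   The value at q = -oo is irrelevant. *)
Definition lorentz_norm p q f : \bar R :=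
  match q with
  | r%:E =>
    (\int[lebesgue_measure]_(t in `]0%R, +oo[)
       (((t `^ fine p^-1)%:E * rearrangement f t) `^ r * (t^-1)%:E)) `^ r^-1
  | _ =>
    ereal_sup [set (t `^ fine p^-1)%:E * rearrangement f t | t in `]0%R, +oo[]
  end.

Lemma open_normc_gt (a : R) :
  @open (R[i] : numFieldType) [set z | (a < Normc.normc z)%R].
Proof.
rewrite openE => z /= az; apply/nbhs_ballP.
exists ((Normc.normc z - a)%:C)%C.
  by rewrite /= -[X in (X < _)%R]/((0 : R)%:C)%C ltcR subr_gt0.
move=> w; rewrite -ball_normE /= -[`|(z - w)%R|%R]/((Normc.normc (z - w)%R)%:C)%C.
rewrite ltcR => zw.
have /= := le_normcD (z - w)%R w; rewrite subrK => zwD.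
by rewrite -(ltrD2l (Normc.normc (z - w)%R)) (lt_le_trans _ zwD)// -ltrBrDr.
Qed.

(* The quantities above only depend on the almost everywhere class of f, so they
   can be evaluated at the representative of a class in {mfun_ mu, X >-> _}. *)
Lemma distribution_ae f g : measurable_fun setT f -> measurable_fun setT g ->
  f = g %[ae mu] -> distribution f = distribution g.
Proof.
move=> mf mg fg; apply/funext => a; rewrite /distribution.
have m (h : X -> borelC R) : measurable_fun setT h ->
    measurable [set x | (a < Normc.normc (h x))%R].
  move=> mh; rewrite -[X in measurable X]setTI.
  apply: (mh measurableT [set z | (a < Normc.normc z)%R]).
  by apply: sub_sigma_algebra; exact: open_normc_gt.
have le (h k : X -> borelC R) : measurable_fun setT h -> measurable_fun setT k ->
    h = k %[ae mu] -> mu [set x | (a < Normc.normc (h x))%R] <=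
                      mu [set x | (a < Normc.normc (k x))%R].
  move=> mh mk [N [mN N0 hkN]].
  rewrite -(measureU0 (m k mk) mN N0).
  rewrite le_measure ?inE//; [exact: m|by apply: measurableU => //; exact: m|].
  move=> x /= ahx; have [hkx|hkx] := pselect (h x = k x).
    by left; rewrite /= -hkx.
  by right; apply: hkN => /= /(_ I).
by apply/eqP; rewrite eq_le !le//; exact: ae_eq_sym.
Qed.

Lemma lorentz_norm_ae p q f g :
  measurable_fun setT f -> measurable_fun setT g ->
  f = g %[ae mu] -> lorentz_norm p q f = lorentz_norm p q g.
Proof.
move=> mf mg fg; rewrite /lorentz_norm /rearrangement.
by rewrite (distribution_ae mf mg fg).
Qed.

End lorentz_functions.

Section lorentz_spaces.
Context (R : realType) (d : measure_display) (X : measurableType d).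
Variable mu : {measure set X -> \bar R}.

Definition lorentz (p q : \bar R) : set {mfun_ mu, X >-> borelC R} :=
  [set f | lorentz_norm mu p q f < +oo].

Definition ilorentz_norm (J : set R) (q : \bar R)
    (f : {mfun_ mu, X >-> borelC R}) : \bar R :=
  ereal_sup [set lorentz_norm mu p%:E q f | p in J].

Definition ilorentz (J : set R) (q : \bar R) :
    set {mfun_ mu, X >-> borelC R} :=
  \bigcap_(p in J) lorentz p%:E q `&` [set f | ilorentz_norm J q f < +oo].

End lorentz_spaces.

Arguments lorentz {R d X} mu p q _.
Arguments ilorentz_norm {R d X} mu J q f.
Arguments ilorentz {R d X} mu J q _.

(* Main.v *)
(** For finite q the bound is the pointwise inequality
    t^(q/p) <= t^(q/m) + t^(q/M) for m <= p <= M, integrated against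
    f^*(t)^q dt/t. Conversely, m = inf J and M = sup J are limits of points p_n
    of J, so Fatou's lemma bounds the norms with exponents m and M by the
    supremum of the norms over J. Hence IL_(J, q) depends on inf J and sup J
    only. For q = +oo, the same works with a maximum in place of the sum and a
    pointwise limit in place of Fatou's lemma. *)
Require Import Defs.
From mathcomp Require Import all_boot all_order all_algebra.
From mathcomp Require Import all_classical all_reals all_analysis.
From mathcomp Require Import measurable_realfun.

Set Implicit Arguments.
Unset Strict Implicit.
Unset Printing Implicit Defensive.

Import Order.TTheory GRing.Theory Num.Theory.
Import numFieldNormedType.Exports.

Local Open Scope classical_set_scope.
Local Open Scope ring_scope.
Local Open Scope ereal_scope.

(** * Monotone functions, real powers and adherent points *)

(** Each set where [f] exceeds a given real is closed downwards, hence an interval, and such sets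
    generate the measurable structure of the codomain. *)
Lemma nonincreasing_emeasurable (R : realType) (D : set R) (f : R -> \bar R) :
  measurable D -> {homo f : s t / (s <= t)%R >-> t <= s} -> measurable_fun D f.
Proof.
move=> mD f_ni.
apply: (measurability _ (ErealGenOInfty.measurableE R)) => // _ [_ [x ->] <-].
apply: measurableI => //; apply: is_interval_measurable => s t/=.
rewrite !in_itv/= !andbT => xs xt u /andP[su ut].
by rewrite in_itv/= andbT (lt_le_trans xt)// f_ni.
Qed.

Lemma le_poweR (R : realType) (s : R) (x y : \bar R) :
  (0 <= s)%R -> 0 <= x -> x <= y -> x `^ s <= y `^ s.
Proof.
move=> s0 x0 xy; apply: gt0_ler_poweR => //; rewrite in_itv/= leey andbT//.
exact: le_trans xy.
Qed.

(** As a function of the exponent, a power of [t] is nondecreasing for [1 <= t] and nonincreasing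
    for [t < 1], so one of the extreme exponents dominates. *)
Lemma powR_le_max (R : realType) (t a b c : R) : (0 < t)%R ->
  (a <= b)%R -> (b <= c)%R -> (t `^ b <= Num.max (t `^ a) (t `^ c))%R.
Proof.
move=> t0 ab bc; rewrite le_max; have [t1|t1] := leP 1%R t.
  by rewrite orbC ler_powR.
by rewrite ger_powR// t0 ltW.
Qed.

Lemma cvg_powRr (R : realType) (T : Type) (F : set_system T) (FF : Filter F)
    (u : T -> R) (a t : R) :
  (0 < t)%R -> u x @[x --> F] --> a -> (t `^ (u x))%R @[x --> F] --> (t `^ a)%R.
Proof.
move=> t0 ua.
have E b : (t `^ b)%R = expR (b * ln t) by rewrite /powR gt_eqF.
under eq_fun do rewrite E.
rewrite E; apply: (cvg_comp (fun x => u x * ln t)%R (@expR R)).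
  by apply: cvgM; [exact: ua|exact: cvg_cst].
exact: continuous_expR.
Qed.

Lemma cvge_powRrZ (R : realType) (T : Type) (F : set_system T)
    (FF : Filter F) (u : T -> R) (a t : R) (C : \bar R) : (0 < t)%R ->
  u x @[x --> F] --> a ->
  (t `^ (u x))%:E * C @[x --> F] --> (t `^ a)%:E * C.
Proof.
move=> t0 ua; apply: cvgeM; last exact: cvg_cst.
  (* The limit of the powers is finite and nonzero, so its product with [C] is never of the form 0
     times infinity, even for infinite [C]. *)
  by rewrite mule_defE eqe gt_eqF ?powR_gt0//= andbF.
apply: cvg_EFin; first exact: nearW.
exact: cvg_powRr.
Qed.

Lemma closure_inf (R : realType) (A : set R) :
  A !=set0 -> has_lbound A -> closure A (inf A).
Proof.
move=> A0 lA U /nbhs_ballP[e /= e0 eU].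
have [x Ax xA] := inf_adherent e0 (conj A0 lA).
exists x; split => //; apply: eU; rewrite /ball/= ltr_distlC.
by rewrite xA andbT (lt_le_trans _ (ge_inf lA Ax))// ltrBlDr ltrDl.
Qed.

(** Turns adherence into a sequence, the form in which Fatou's lemma can be applied; the n-th point
    is chosen within 1/(n+1) of [a]. *)
Lemma closure_cvg_seq (R : realType) (A : set R) (a : R) :
  closure A a -> exists2 u : R^nat, (forall n, A (u n)) & u @ \oo --> a.
Proof.
move=> Aa.
have /choice[u uP] (n : nat) : exists x, A x /\ (`|a - x| < n.+1%:R^-1)%R.
  have [|x [Ax xa]] := Aa (ball a n.+1%:R^-1); last by exists x.
  by apply: nbhsx_ballx; rewrite invr_gt0.
exists u => [n|]; first by case: (uP n).
apply/cvgrPdist_lt => e e0; near=> n.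
apply: (lt_trans (proj2 (uP n))); near: n.
exact: (near_infty_natSinv_lt (PosNum e0)).
Unshelve. all: by end_near. Qed.

(** * The Lorentz norm as a function of its first exponent *)

Section lorentz_norm_theory.
Context (R : realType) (d : measure_display) (X : measurableType d).
Variable mu : {measure set X -> \bar R}.
Implicit Types (f : X -> borelC R) (p r t : R).

Lemma rearrangement_ge0 f t : 0 <= rearrangement mu f t.
Proof. by apply: le_ereal_inf_tmp => _ [s [/ltW s0 _] <-]; rewrite lee_fin. Qed.

Lemma rearrangement_nonincreasing f :
  {homo rearrangement mu f : s t / (s <= t)%R >-> t <= s}.
Proof.
move=> s t st; apply: ereal_inf_le_tmp => _ [a [a0 fa] <-].
by exists a => //; split => //; rewrite (le_trans fa)// lee_fin.
Qed.

(* The factor t^-1 of the measure dt/t is absorbed in the power of t; this agrees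
   with the integrand of lorentz_norm for t > 0 only. *)
Definition lorentz_integrand p r f t : \bar R :=
  (t `^ (p^-1 * r - 1))%:E * rearrangement mu f t `^ r.

Lemma lorentz_normE p r f :
  lorentz_norm mu p%:E r%:E f =
  (\int[lebesgue_measure]_(t in `]0%R, +oo[) lorentz_integrand p r f t) `^ r^-1.
Proof.
rewrite /lorentz_norm/= fine_invr; congr (_ `^ _).
apply: eq_integral => t; rewrite inE/= in_itv/= andbT => t0.
rewrite poweRM ?rearrangement_ge0 ?lee_fin ?powR_ge0//.
rewrite poweR_EFin -powRrM muleAC -EFinM /lorentz_integrand.
by rewrite powRB ?(gt_eqF t0) ?implybT// powRr1 ?ltW.
Qed.

Lemma lorentz_integrand_ge0 p r f t : 0 <= lorentz_integrand p r f t.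
Proof. by rewrite mule_ge0 ?poweR_ge0// lee_fin powR_ge0. Qed.

Lemma measurable_lorentz_integrand (D : set R) p r f : measurable D ->
  measurable_fun D (lorentz_integrand p r f).
Proof.
move=> mD; apply: emeasurable_funM; last first.
  apply: (measurableT_comp (measurable_poweR r)).
  apply: nonincreasing_emeasurable => //.
  exact: rearrangement_nonincreasing.
apply/measurable_EFinP; apply: measurable_funTS; exact: measurable_powR.
Qed.

Lemma lorentz_integral_ge0 p r f :
  0 <= \int[lebesgue_measure]_(t in `]0%R, +oo[) lorentz_integrand p r f t.
Proof. by apply: integral_ge0 => t _; exact: lorentz_integrand_ge0. Qed.

Lemma lorentz_integrand_cvg (u : R^nat) p r f t : (0 < t)%R -> p != 0%R ->
  u @ \oo --> p ->
  lorentz_integrand (u n) r f t @[n --> \oo] --> lorentz_integrand p r f t.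
Proof.
move=> t0 p0 up; apply: cvge_powRrZ => //.
apply: cvgB; last exact: cvg_cst.
by apply: cvgM; [exact: cvgV|exact: cvg_cst].
Qed.

Lemma lorentz_norm_itv_le (m M p : R) (q : \bar R) f : 0 < q ->
  (0 < m)%R -> (m <= p)%R -> (p <= M)%R ->
  lorentz_norm mu p%:E q f <= (2 `^ fine q^-1)%:E *
    maxe (lorentz_norm mu m%:E q f) (lorentz_norm mu M%:E q f).
Proof.
move=> q0 m0 mp pM.
have p0 : (0 < p)%R := lt_le_trans m0 mp.
have M0 : (0 < M)%R := lt_le_trans p0 pM.
(* Inversion reverses the order: 1/M is the least exponent of t and 1/m the greatest. *)
have pm : (p^-1 <= m^-1)%R by rewrite lef_pV2.
have Mp : (M^-1 <= p^-1)%R by rewrite lef_pV2.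
case: q q0 => [r| |//]; last first.
  (* For [q = +oo] the inverse of [q] is 0, so the constant is 2^0 = 1. *)
  move=> _; rewrite invey powRr0 mul1e /lorentz_norm !fine_invr.
  apply: ge_ereal_sup => _ [t t0 <-].
  have tpos : (0 < t)%R by move: t0; rewrite /= in_itv/= andbT.
  have := powR_le_max tpos Mp pm; rewrite le_max => /orP[h|h];
    rewrite le_max; apply/orP; [right|left];
    (apply: le_trans; last by apply: ereal_sup_ubound; exists t);
    by rewrite lee_wpmul2r ?rearrangement_ge0// lee_fin.
rewrite lte_fin => r0; rewrite !lorentz_normE fine_invr.
set I := fun p => \int[lebesgue_measure]_(t in `]0%R, +oo[)
  lorentz_integrand p r f t.
rewrite -![integral _ _ _]/(I _).
have I0 a : 0 <= I a := lorentz_integral_ge0 a r f.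
have Ile : I p <= I m + I M.
  rewrite /I -ge0_integralD//=; do ?exact: measurable_lorentz_integrand;
    do ?[by move=> t _; exact: lorentz_integrand_ge0].
  apply: ge0_le_integral => //=; do ?exact: measurable_lorentz_integrand.
  - by move=> t _; exact: lorentz_integrand_ge0.
  - by apply: emeasurable_funD; exact: measurable_lorentz_integrand.
  move=> t; rewrite in_itv/= andbT => t0.
  rewrite /lorentz_integrand -ge0_muleDl ?lee_fin ?powR_ge0//.
  rewrite lee_wpmul2r ?poweR_ge0// lee_fin.
  have Mpr : (M^-1 * r - 1 <= p^-1 * r - 1)%R by rewrite lerD2r ler_pM2r.
  have pmr : (p^-1 * r - 1 <= m^-1 * r - 1)%R by rewrite lerD2r ler_pM2r.
  apply: (le_trans (powR_le_max t0 Mpr pmr)).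
  by rewrite ge_max lerDl lerDr !powR_ge0.
(* The sum is replaced by twice the maximum, so that the r-th root turns the factor 2 into 2^(1/r)
   and passes inside the maximum. *)
have Imax : I p <= 2%:E * maxe (I m) (I M).
  apply: (le_trans Ile).
  rewrite -[2%R]/(1 + 1)%R EFinD ge0_muleDl ?lee_fin// !mul1e.
  by rewrite leeD// le_max lexx ?orbT.
have rV0 : (0 <= r^-1)%R by rewrite invr_ge0 ltW.
apply: (le_trans (le_poweR rV0 (I0 p) Imax)).
rewrite poweRM ?lee_fin ?le_max ?I0//.
rewrite poweR_EFin lee_wpmul2l ?lee_fin ?powR_ge0//.
by have [h|h] := leP (I m) (I M); rewrite le_max lexx ?orbT.
Qed.

(** Lower semicontinuity of the norm in the exponent: a uniform bound over [J] passes to positive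
    adherent points of [J]. *)
Lemma lorentz_norm_le_closure (J : set R) (a : R) (q C : \bar R) f : 0 < q ->
  (0 < a)%R -> closure J a ->
  (forall p, J p -> lorentz_norm mu p%:E q f <= C) ->
  lorentz_norm mu a%:E q f <= C.
Proof.
move=> q0 a0 /closure_cvg_seq[u uJ ua] JC.
have {}JC n := JC _ (uJ n).
have a_neq0 : a != 0%R by rewrite gt_eqF.
case: q q0 JC => [r| |//]; last first.
  move=> _ JC; rewrite /lorentz_norm fine_invr.
  apply: ge_ereal_sup => _ [t t0 <-].
  have tpos : (0 < t)%R by move: t0; rewrite /= in_itv/= andbT.
  have cv : (t `^ (u n)^-1)%:E * rearrangement mu f t @[n --> \oo] -->
            (t `^ a^-1)%:E * rearrangement mu f t.
    by apply: cvge_powRrZ => //; exact: cvgV.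
  apply: (cvge_to_le cv); apply: nearW => n.
  apply: le_trans (JC n); rewrite /lorentz_norm fine_invr.
  by apply: ereal_sup_ubound; exists t.
rewrite lte_fin => r0 JC; rewrite lorentz_normE.
(* Nonnegativity ensures that raising [C] to the powers r and then 1/r gives back [C]. *)
have C0 : 0 <= C by apply: le_trans (JC 0%N); rewrite lorentz_normE poweR_ge0.
suff : \int[lebesgue_measure]_(t in `]0%R, +oo[) lorentz_integrand a r f t
    <= C `^ r.
  move=> /le_poweR H; apply: (le_trans (H r^-1%R _ _)).
  - by rewrite invr_ge0 ltW.
  - exact: lorentz_integral_ge0.
  - by rewrite -poweRrM divff ?gt_eqF// poweRe1.
have IC n : \int[lebesgue_measure]_(t in `]0%R, +oo[)
    lorentz_integrand (u n) r f t <= C `^ r.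
  have := le_poweR (ltW r0) _ (JC n).
  rewrite lorentz_normE poweR_ge0 -poweRrM mulVf ?gt_eqF// poweRe1.
    exact.
  exact: lorentz_integral_ge0.
(* The integrands converge pointwise for t > 0, so the limit integrand equals their lower limit, as
   Fatou's lemma requires. *)
have -> : \int[lebesgue_measure]_(t in `]0%R, +oo[) lorentz_integrand a r f t =
    \int[lebesgue_measure]_(t in `]0%R, +oo[)
      limn_einf (fun n => lorentz_integrand (u n) r f t).
  apply: eq_integral => t; rewrite inE/= in_itv/= andbT => t0.
  have cv := @lorentz_integrand_cvg u a r f t t0 a_neq0 ua.
  by have [-> _] := cvg_limn_einf_sup cv.
apply: le_trans.
  apply: fatou => // [n|n t _]; first exact: measurable_lorentz_integrand.
  exact: lorentz_integrand_ge0.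
(* The lower limit is the limit of the infima over tails, and each of these is at most the first
   term of its tail. *)
rewrite limn_einf_lim; apply: lime_le; first exact: is_cvg_einfs.
apply: nearW => n; apply: le_trans (IC n).
by apply: ereal_inf_lbound; exists n => /=.
Qed.

End lorentz_norm_theory.

(** * Reduction of the intersection space to its endpoint exponents *)

(** Stated for a general [J] so that it applies both to the given set and to each interval with the
    same infimum and supremum. *)
Lemma ilorentz_inf_sup (R : realType) (d : measure_display)
    (X : measurableType d) (mu : {measure set X -> \bar R}) (q : \bar R)
    (J : set R) : 0 < q -> J !=set0 -> has_lbound J -> (0 < inf J)%R ->
  has_ubound J ->
  ilorentz mu J q = lorentz mu (inf J)%:E q `&` lorentz mu (sup J)%:E q.
Proof.
move=> q0 J0 lJ infJ0 uJ; apply/seteqP; split => f.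
- move=> [_]; rewrite /ilorentz_norm/= => fJ.
  have supJ0 : (0 < sup J)%R.
    have [x Jx] := J0; apply: (lt_le_trans infJ0).
    by apply: (le_trans (ge_inf lJ Jx)); exact: ub_le_sup.
  split; apply: le_lt_trans fJ;
    (apply: (lorentz_norm_le_closure (J := J)) => //;
      [exact: closure_inf || exact: closure_sup|]);
    by move=> p Jp; apply: ereal_sup_ubound; exists p.
- move=> [fm fM].
  (* This bound is independent of [p], so it yields both membership for every exponent in [J] and
     finiteness of the supremum. *)
  have le p : J p -> lorentz_norm mu p%:E q f <= (2 `^ fine q^-1)%:E *
      maxe (lorentz_norm mu (inf J)%:E q f) (lorentz_norm mu (sup J)%:E q f).
    move=> Jp; apply: lorentz_norm_itv_le => //; first exact: ge_inf.
    exact: ub_le_sup.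
  have fin : (2 `^ fine q^-1)%:E * maxe (lorentz_norm mu (inf J)%:E q f)
      (lorentz_norm mu (sup J)%:E q f) < +oo.
    by rewrite lte_mul_pinfty ?lee_fin ?powR_ge0// gt_max fm.
  split => [p Jp|]; first exact: le_lt_trans (le p Jp) fin.
  by apply: le_lt_trans fin; apply: ge_ereal_sup => _ [p Jp <-]; exact: le.
Qed.

Theorem proposition3p5 (R : realType) (d : measure_display)
    (X : measurableType d) (mu : {measure set X -> \bar R})
    (q : \bar R) (J : set R)
    (q_gt0 : 0 < q)
    (J_neq0 : J !=set0)
    (J_gt0 : J `<=` `]0%R, +oo[)
    (infJ_gt0 : (0 < inf J)%R)
    (supJ_fin : has_ubound J) :
  [/\ ((inf J < sup J)%R -> ilorentz mu J q = ilorentz mu `]inf J, sup J[ q),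
      ((inf J < sup J)%R -> ilorentz mu J q = ilorentz mu `[inf J, sup J[ q),
      ((inf J < sup J)%R -> ilorentz mu J q = ilorentz mu `]inf J, sup J] q),
      ilorentz mu J q = ilorentz mu `[inf J, sup J] q &
      ilorentz mu J q =
        lorentz mu (inf J)%:E q `&` lorentz mu (sup J)%:E q] /\
  (forall f, ilorentz mu J q f -> forall p, J p ->
     lorentz_norm mu p%:E q f <=
       (2 `^ fine q^-1)%:E *
       maxe (lorentz_norm mu (inf J)%:E q f) (lorentz_norm mu (sup J)%:E q f)).
Proof.
have lJ : has_lbound J.
  by exists 0%R => x /J_gt0; rewrite /= in_itv/= andbT => /ltW.
have JE := ilorentz_inf_sup mu q_gt0 J_neq0 lJ infJ_gt0 supJ_fin.
have infsup : (inf J <= sup J)%R.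
  have [x Jx] := J_neq0.
  by apply: (le_trans (ge_inf lJ Jx)); exact: ub_le_sup.
set m := inf J in JE infJ_gt0 infsup *; set M := sup J in JE infsup *.
(* The order on bounds expresses that the interval is nonempty: it means m < M when an endpoint is
   missing, but only m <= M for the closed interval. *)
have itvE (a b : bool) : (BSide a m < BSide b M)%O ->
    ilorentz mu J q = ilorentz mu [set` Interval (BSide a m) (BSide b M)] q.
  set I := [set` _] => ab.
  have infI : inf I = m by rewrite inf_itv.
  have supI : sup I = M by rewrite sup_itv.
  have mMI x : I x -> (m <= x <= M)%R.
    move=> Ix; have : `[m, M]%classic x.
      by apply: subset_itvScc Ix; rewrite bnd_simp.
    by rewrite /= in_itv.
  rewrite (@ilorentz_inf_sup R d X mu q I).
  - by rewrite infI supI.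
  - exact: q_gt0.
  - by apply/set0P; exact/neitvP.
  - by exists m => x /mMI/andP[].
  - by rewrite infI.
  - by exists M => x /mMI/andP[].
split; first split.
- by move=> mM; apply: itvE; rewrite bnd_simp.
- by move=> mM; apply: itvE; rewrite bnd_simp.
- by move=> mM; apply: itvE; rewrite bnd_simp.
- by apply: itvE; rewrite bnd_simp.
- exact: JE.
move=> f _ p Jp; apply: lorentz_norm_itv_le => //.
- exact: (ge_inf lJ).
- exact: ub_le_sup.
Qed.
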